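(* There exists a unique family of Laurent series $\psi^s_{a,b}(z)\in\mathbb C((z))$, indexed by $a,b\in\frac12+\mathbb Z$ and $s\in\{0,1\}$, satisfying for all $a,b\in\frac12+\mathbb Z$, $s\in\{0,1\}$: (c1) $\psi^s_{a,b}(z)(z^3+z+z^{-1}+z^{-3})=\psi^s_{a+1,b}(z)+\psi^s_{a-1,b}(z)+\psi^s_{a,b+1}(z)+\psi^s_{a,b-1}(z)$; (c2) $\psi^s_{a,b}(z)(z^4+z^2+1+z^{-2}+z^{-4})=\psi^s_{a+1,b+1}(z)+\psi^s_{a+1,b-1}(z)+\psi^s_{a-1,b+1}(z)+\psi^s_{a-1,b-1}(z)+\psi^s_{a,b}(z)$; (c3) $\psi^s_{a,b}(z)=-\psi^s_{b,a}(z)=-\psi^s_{-b,-a}(z)=\psi^s_{-a,-b}(z)$; (c4) $\psi^s_{\frac32,\frac12}(z)=\dfrac{z^s}{1-z^6}$, $\ \psi^s_{\frac32,-\frac12}(z)=\dfrac{z^{3+s}}{1-z^6}$. Moreover, $$\psi^s_{a,b}(z)=\frac{z^{5+s}\big(z^{3a+b}-z^{a+3b}-z^{-a-3b}+z^{-3a-b}\big)-z^{6+s}\big(z^{3a-b}-z^{-a+3b}-z^{a-3b}+z^{-3a+b}\big)}{(1-z^2)^2(1-z^4)(1-z^6)}.$$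
   Context: $\mathbb C((z))$ is the field of formal Laurent series in $z$ over $\mathbb C$; rational functions are expanded at $z=0$. *)

(* Defs.v *)
From HB Require Import structures.
From mathcomp Require Import all_boot all_order all_algebra.
From mathcomp Require Import all_classical reals.
From mathcomp Require Import complex.
From mathcomp Require Import zify lra.

Set Implicit Arguments.
Unset Strict Implicit.
Unset Printing Implicit Defensive.

Import Order.TTheory GRing.Theory Num.Theory.
Local Open Scope ring_scope.

Definition vanishes_below (F : fieldType) (n0 : int) (f : int -> F) : Prop :=
  forall n : int, n < n0 -> f n = 0.

Record laurent (F : fieldType) := Laurent {
  lcoef :> int -> F;
  lcoefP : exists n0 : int, vanishes_below n0 lcoef }.

HB.instance Definition _ (F : fieldType) := gen_eqMixin (laurent F).
HB.instance Definition _ (F : fieldType) := gen_choiceMixin (laurent F).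

Section LaurentField.
Variable F : fieldType.
Implicit Types (f g h : laurent F) (u v : int -> F) (a b n : int) (k K : nat).

Lemma laurentP f g : f =1 g -> f = g.
Proof.
case: f g => [f fP] [g gP] /= /funext efg; case: _ / efg in gP *.
by rewrite (Prop_irrelevance fP gP).
Qed.

Lemma vanishes_belowW a b u :
  a <= b -> vanishes_below b u -> vanishes_below a u.
Proof. by move=> ab ub n na; apply: ub; apply: lt_le_trans ab. Qed.

Lemma lzero_subproof : exists n0, vanishes_below n0 (fun=> 0 : F).
Proof. by exists 0. Qed.
Definition lzero := Laurent lzero_subproof.

Lemma lopp_subproof f : exists n0, vanishes_below n0 (fun n => - f n).
Proof. by have [a fa] := lcoefP f; exists a => n /fa ->; rewrite oppr0. Qed.
Definition lopp f := Laurent (lopp_subproof f).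

Lemma ladd_subproof f g : exists n0, vanishes_below n0 (fun n => f n + g n).
Proof.
have [[a fa] [b gb]] := (lcoefP f, lcoefP g).
exists (Num.min a b) => n; rewrite lt_min => /andP[/fa -> /gb ->].
by rewrite addr0.
Qed.
Definition ladd f g := Laurent (ladd_subproof f g).

(* The nonzero terms of this sum are finitely many as soon as u and v vanish
   below some index, so that the finitely-supported sum is the usual one. *)
Definition lconv u v n : F := \sum_(i \in [set: int]) u i * v (n - i).

Lemma lconv_vanishes a b u v : vanishes_below a u -> vanishes_below b v ->
  vanishes_below (a + b) (lconv u v).
Proof.
move=> ua vb n nab; apply: fsbig1 => i _.
have [/ua ->|ai] := ltP i a; first by rewrite mul0r.
by rewrite vb ?mulr0//; lia.
Qed.

Lemma lmul_subproof f g : exists n0, vanishes_below n0 (lconv f g).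
Proof.
have [[a fa] [b gb]] := (lcoefP f, lcoefP g).
by exists (a + b); apply: lconv_vanishes.
Qed.
Definition lmul f g := Laurent (lmul_subproof f g).

Definition lmonom_coef (m n : int) : F := (n == m)%:R.
Lemma lmonom_subproof m : exists n0, vanishes_below n0 (lmonom_coef m).
Proof.
by exists m => n; rewrite /lmonom_coef lt_neqAle => /andP[/negPf ->].
Qed.
Definition lmonom m := Laurent (lmonom_subproof m).

Let trunc a K u : {poly F} := \poly_(i < K) u (a + i%:Z).

Let lconvE a b u v k K : vanishes_below a u -> vanishes_below b v ->
  (k < K)%N -> lconv u v (a + b + k%:Z) = (trunc a K u * trunc b K v)`_k.
Proof.
move=> ua vb kK; rewrite coefM /lconv.
rewrite (fsbigE [seq a + i%:Z | i <- iota 0 k.+1]); first last.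
- move=> i _ ni; have [/ua ->|ai] := ltP i a; first by rewrite mul0r.
  rewrite (vb (_ - i)) ?mulr0//; rewrite ltNge; apply: contraNN ni => kib.
  apply/mapP; exists `|i - a|%N; last by lia.
  by rewrite mem_iota; lia.
- by [].
- by rewrite map_inj_uniq ?iota_uniq// => i j /addrI [].
rewrite big_map (eq_bigl xpredT); last by move=> i; rewrite in_setT.
rewrite -[iota 0 k.+1]/(index_iota 0 k.+1) big_mkord; apply: eq_bigr => i _.
have ik := ltn_ord i; rewrite !coef_poly !ifT; [|lia|lia].
by congr (_ * v _); lia.
Qed.

Let laurent_eq_above a f g : vanishes_below a f -> vanishes_below a g ->
  (forall k, f (a + k%:Z) = g (a + k%:Z)) -> f = g.
Proof.
move=> fa ga fg; apply: laurentP => n; have [na|an] := ltP n a.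
  by rewrite fa ?ga.
by have -> : n = a + `|n - a|%N%:Z by lia.
Qed.

Fact laddA : associative ladd.
Proof. by move=> f g h; apply: laurentP => n; apply: addrA. Qed.
Fact laddC : commutative ladd.
Proof. by move=> f g; apply: laurentP => n; apply: addrC. Qed.
Fact ladd0 : left_id lzero ladd.
Proof. by move=> f; apply: laurentP => n; apply: add0r. Qed.
Fact laddN : left_inverse lzero lopp ladd.
Proof. by move=> f; apply: laurentP => n; apply: addNr. Qed.

Fact lmulC : commutative lmul.
Proof.
move=> f g; have [[a fa] [b gb]] := (lcoefP f, lcoefP g).
apply: (@laurent_eq_above (a + b)) => [||k].
- exact: lconv_vanishes.
- by rewrite addrC; apply: lconv_vanishes.
rewrite /= (lconvE fa gb (ltnSn k)) [a + b]addrC (lconvE gb fa (ltnSn k)).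
by rewrite mulrC.
Qed.

Let coefM_eq (p p' q q' : {poly F}) k :
  (forall i, (i <= k)%N -> p`_i = p'`_i) ->
  (forall i, (i <= k)%N -> q`_i = q'`_i) -> (p * q)`_k = (p' * q')`_k.
Proof.
move=> pp qq; rewrite !coefM; apply: eq_bigr => i _.
by rewrite pp ?qq ?leq_subr // -ltnS.
Qed.

Let trunc_conv a b u v K i : vanishes_below a u -> vanishes_below b v ->
  (i < K)%N ->
  (trunc (a + b) K (lconv u v))`_i = (trunc a K u * trunc b K v)`_i.
Proof. by move=> ua vb iK; rewrite coef_poly iK; apply: lconvE. Qed.

Fact lmulA : associative lmul.
Proof.
move=> f g h.
have [[[a fa] [b gb]] [c hc]] := (lcoefP f, lcoefP g, lcoefP h).
have fg := lconv_vanishes fa gb; have gh := lconv_vanishes gb hc.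
apply: (@laurent_eq_above (a + b + c)) => [||k].
- by rewrite -addrA; apply: lconv_vanishes.
- exact: lconv_vanishes.
rewrite /= (lconvE fg hc (ltnSn k)) -(addrA a b c) (lconvE fa gh (ltnSn k)).
transitivity ((trunc a k.+1 f * (trunc b k.+1 g * trunc c k.+1 h))`_k).
  by apply: coefM_eq => // i ik; apply: trunc_conv.
by rewrite mulrA; apply: coefM_eq => // i ik; rewrite trunc_conv.
Qed.

Fact lmul1 : left_id (lmonom 0) lmul.
Proof.
move=> f; apply: laurentP => n; rewrite /= /lconv (fsbigE [:: 0])//.
  by rewrite big_mkcond big_seq1 in_setT /lmonom_coef eqxx mul1r subr0.
move=> i _; rewrite inE /lmonom_coef => /negPf ->.
by rewrite mul0r.
Qed.

Fact lmulDl : left_distributive lmul ladd.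
Proof.
move=> f g h.
have [[[a fa] [b gb]] [c hc]] := (lcoefP f, lcoefP g, lcoefP h).
pose m := Num.min a b.
have {}fa : vanishes_below m f by apply: vanishes_belowW fa; rewrite ge_min lexx.
have {}gb : vanishes_below m g.
  by apply: vanishes_belowW gb; rewrite ge_min lexx orbT.
have fg : vanishes_below m (ladd f g) by move=> n nm; rewrite /= fa ?gb ?addr0.
have fgh := lconv_vanishes fg hc.
have fh := lconv_vanishes fa hc; have gh := lconv_vanishes gb hc.
apply: (@laurent_eq_above (m + c)) => [//||k].
  by move=> n nm; rewrite /= fh ?gh ?addr0.
rewrite /= -/(lcoef _) (lconvE fg hc (ltnSn k)) (lconvE fa hc (ltnSn k)).
rewrite (lconvE gb hc (ltnSn k)) -coefD -mulrDl.
by apply: coefM_eq => // i ik; rewrite coefD !coef_poly ltnS ik.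
Qed.

Fact lone_neq0 : lmonom 0 <> lzero.
Proof.
move=> /(congr1 (fun f => lcoef f 0)) /eqP.
by rewrite /= /lmonom_coef eqxx oner_eq0.
Qed.

Definition linv f : laurent F := xget lzero [set g | lmul g f = lmonom 0].

Let leading f : f <> lzero -> exists2 a, vanishes_below a f & f a != 0.
Proof.
move=> f0; have [a fa] := lcoefP f.
have ex : exists k, f (a + k%:Z) != 0.
  apply: contrapT => /forallNP nex; apply: f0.
  apply: (laurent_eq_above fa) => // k.
  by apply/eqP/negPn/negP/nex.
case: (ex_minnP ex) => k fk mink; exists (a + k%:Z) => // n nk.
have [/fa//|an] := ltP n a.
apply/eqP/negPn/negP => fn; have := mink `|n - a|%N.
have -> : a + `|n - a|%N%:Z = n by lia.
by move=> /(_ fn); lia.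
Qed.

Fixpoint inv_coefs u k : seq F :=
  if k is k'.+1 then
    let s := inv_coefs u k' in
    rcons s ((u 0)^-1 *
             ((k' == 0%N)%:R - \sum_(i < k') s`_i * u (k' - i)%N%:Z))
  else [::].

Let size_inv_coefs u k : size (inv_coefs u k) = k.
Proof. by elim: k => //= k IH; rewrite size_rcons IH. Qed.

Let nth_inv_coefs u k i : (i < k)%N ->
  (inv_coefs u k)`_i = (inv_coefs u i.+1)`_i.
Proof.
elim: k => // k IH; rewrite ltnS leq_eqVlt => /predU1P[->//|ik].
by rewrite [inv_coefs u k.+1]/= nth_rcons size_inv_coefs ik IH.
Qed.

Let inv_coefsE u k : u 0 != 0 ->
  \sum_(i < k.+1) (inv_coefs u i.+1)`_i * u (k - i)%N%:Z = (k == 0%N)%:R.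
Proof.
move=> u0; rewrite big_ord_recr /= subnn.
rewrite nth_rcons size_inv_coefs ltnn eqxx mulrAC mulVf// mul1r.
under [X in _ - X]eq_bigr => i _ do rewrite nth_inv_coefs//.
by rewrite addrC subrK.
Qed.

Fact lmulVf f : f <> lzero -> lmul (linv f) f = lmonom 0.
Proof.
move=> /leading[a fa fa0].
suff : exists g, lmul g f = lmonom 0 by exact: xgetPex.
pose u (i : int) := f (a + i).
pose v (n : int) := if n < - a then 0 else
  (inv_coefs u (absz (n + a)).+1)`_(absz (n + a)).
have va : vanishes_below (- a) v by move=> n; rewrite /v => ->.
have vP : exists n0, vanishes_below n0 v by exists (- a).
exists (Laurent vP).
apply: (@laurent_eq_above 0) => [||k].
- by rewrite -(addNr a); apply: lconv_vanishes.
- by move=> n; rewrite /= /lmonom_coef lt_neqAle => /andP[/negPf ->].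
have := lconvE va fa (ltnSn k); rewrite addNr /= => ->.
have u0 : u 0 != 0 by rewrite /u addr0.
rewrite coefM /lmonom_coef add0r -[RHS](inv_coefsE k u0).
apply: eq_bigr => i _; have ik := ltn_ord i.
rewrite !coef_poly ik ltnS leq_subr /v ifF; last by lia.
by have -> : absz (- a + i%:Z + a) = i by lia.
Qed.

Fact linv0 : linv lzero = lzero.
Proof.
rewrite /linv; case: xgetP => // g _ /= g0.
case: lone_neq0; rewrite -g0; apply: laurentP => n.
by apply: fsbig1 => i _ /=; rewrite mulr0.
Qed.

End LaurentField.

HB.instance Definition _ (F : fieldType) := GRing.isZmodule.Build (laurent F)
  (@laddA F) (@laddC F) (@ladd0 F) (@laddN F).

Fact lone_neq0b (F : fieldType) : lmonom F 0 != 0.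
Proof. by apply/eqP; exact: lone_neq0. Qed.

HB.instance Definition _ (F : fieldType) :=
  GRing.Zmodule_isComNzRing.Build (laurent F)
    (@lmulA F) (@lmulC F) (@lmul1 F) (@lmulDl F) (@lone_neq0b F).

Fact lmulVfb (F : fieldType) (f : laurent F) : f != 0 -> linv f * f = 1.
Proof. by move=> /eqP; exact: lmulVf. Qed.

HB.instance Definition _ (F : fieldType) :=
  GRing.ComNzRing_isField.Build (laurent F) (@lmulVfb F) (@linv0 F).

Definition laurentX (F : fieldType) : laurent F := lmonom F 1.

Definition half_odd : {pred rat} := [pred x : rat | x - 1 / 2 \is a Num.int].

Record halfint := HalfInt { halfint_val :> rat; _ : halfint_val \in half_odd }.

HB.instance Definition _ := [isSub for halfint_val].
HB.instance Definition _ := [Choice of halfint by <:].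

Lemma halfint_of_subproof (k : int) : 1 / 2 + k%:~R \in half_odd.
Proof. by rewrite inE addrAC subrr add0r intr_int. Qed.
Definition halfint_of (k : int) : halfint := HalfInt (halfint_of_subproof k).

Lemma halfint_add_subproof (a : halfint) (k : int) : val a + k%:~R \in half_odd.
Proof. by case: a => a /= ha; rewrite inE addrAC rpredD ?intr_int. Qed.
Definition halfint_add (a : halfint) (k : int) : halfint :=
  HalfInt (halfint_add_subproof a k).

Lemma halfint_opp_subproof (a : halfint) : - val a \in half_odd.
Proof.
case: a => a /=; rewrite !inE => ha.
have -> : - a - 1 / 2 = - (a - 1 / 2) - 1 by lra.
by rewrite rpredB ?rpredN ?rpred1.
Qed.
Definition halfint_opp (a : halfint) : halfint :=
  HalfInt (halfint_opp_subproof a).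

Declare Scope halfint_scope.
Delimit Scope halfint_scope with H.
Bind Scope halfint_scope with halfint.
Notation "a + k" := (halfint_add a k%Z) : halfint_scope.
Notation "a - k" := (halfint_add a (- k%Z)%R) : halfint_scope.
Notation "- a" := (halfint_opp a) : halfint_scope.

(* z^q; only meaningful, and only used, for q an integer. *)
Definition laurentXpow (F : fieldType) (q : rat) : laurent F :=
  laurentX F ^ Num.floor q.

Definition psi_family (R : realType) :=
  'I_2 -> halfint -> halfint -> laurent R[i].

Section Equations.
Variable R : realType.
Implicit Type psi : psi_family R.
Local Notation z := (laurentX R[i]).
Local Notation "''z^' q" := (laurentXpow R[i] q) (at level 2, format "''z^' q").

Definition psi_c1 psi : Prop := forall (a b : halfint) (s : 'I_2),
  psi s a b * (z ^+ 3 + z + z^-1 + z ^- 3) =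
  psi s (a + 1)%H b + psi s (a - 1)%H b + psi s a (b + 1)%H + psi s a (b - 1)%H.

Definition psi_c2 psi : Prop := forall (a b : halfint) (s : 'I_2),
  psi s a b * (z ^+ 4 + z ^+ 2 + 1 + z ^- 2 + z ^- 4) =
  psi s (a + 1)%H (b + 1)%H + psi s (a + 1)%H (b - 1)%H
  + psi s (a - 1)%H (b + 1)%H + psi s (a - 1)%H (b - 1)%H + psi s a b.

Definition psi_c3 psi : Prop := forall (a b : halfint) (s : 'I_2),
  [/\ psi s a b = - psi s b a,
      psi s a b = - psi s (- b)%H (- a)%H &
      psi s a b = psi s (- a)%H (- b)%H].

Definition psi_c4 psi : Prop := forall s : 'I_2,
  psi s (halfint_of 1) (halfint_of 0) = z ^+ s / (1 - z ^+ 6) /\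
  psi s (halfint_of 1) (halfint_of (-1)) = z ^+ (3 + s) / (1 - z ^+ 6).

Definition psi_spec psi : Prop :=
  [/\ psi_c1 psi, psi_c2 psi, psi_c3 psi & psi_c4 psi].

Definition psi_formula (s : 'I_2) (a b : rat) : laurent R[i] :=
  (z ^+ (5 + s) * ('z^(3 * a + b) - 'z^(a + 3 * b)
                   - 'z^(- a - 3 * b) + 'z^(- 3 * a - b))
   - z ^+ (6 + s) * ('z^(3 * a - b) - 'z^(- a + 3 * b)
                     - 'z^(a - 3 * b) + 'z^(- 3 * a + b)))
  / ((1 - z ^+ 2) ^+ 2 * (1 - z ^+ 4) * (1 - z ^+ 6)).

End Equations.

(* Main.v *)
Require Import Defs.
From mathcomp Require Import all_boot all_order all_algebra.
From mathcomp Require Import all_classical reals.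
From mathcomp Require Import complex zify ring lra.

(** In the coordinates u = a - b, v = a + b the shifts in (c1) and (c2) become
    (u +- 1, v +- 1), resp. (u +- 2, v) and (u, v +- 2), and (c3) says that psi
    is odd in u and in v.  With x = z^u and y = z^v the closed formula is a
    combination of (x - x^-1)(y^2 - y^-2) and (x^2 - x^-2)(y - y^-1), so (c1),
    (c2) and (c4) become identities between rational functions of x, y and z.

    For uniqueness, a difference of two solutions vanishes on the walls u = 0
    and v = 0.  By induction on a it vanishes on the cone |b| <= a: (c1) centred
    at (a - 1, b) gives all points at distance at least 2 from the walls, and
    (c2) then gives the two remaining points. *)

Import Order.TTheory GRing.Theory Num.Theory.
Local Open Scope ring_scope.

(** * Powers of z as Laurent series *)

Section LaurentMonomials.
Context {F : fieldType}.
Local Notation z := (laurentX F).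

Lemma laurent_mulXE (f : laurent F) (n : int) :
  lcoef (z * f) n = lcoef f (n - 1).
Proof.
rewrite /= /lconv (fsbigE [:: 1])//.
  by rewrite big_mkcond big_seq1 in_setT /lmonom_coef eqxx mul1r.
by move=> i _; rewrite inE /lmonom_coef => /negPf ->; rewrite mul0r.
Qed.

Lemma lcoef_expX (k : nat) (n : int) :
  lcoef (z ^+ k) n = (n == k%:Z)%:R.
Proof.
elim: k n => [//|k IH] n; rewrite exprS laurent_mulXE IH.
by rewrite subr_eq (_ : k.+1%:Z = k%:Z + 1)//; lia.
Qed.

Lemma laurentX_neq0 : z != 0.
Proof.
apply/eqP => /(congr1 (fun f => lcoef f 1)) /eqP.
by rewrite /= /lmonom_coef eqxx oner_eq0.
Qed.

(** The two series differ in the coefficient of index 0. This clears the denominators in (c4). *)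
Lemma laurentX_sub1_neq0 (k : nat) : (0 < k)%N -> 1 - z ^+ k != 0.
Proof.
move=> k0; rewrite subr_eq0; apply/eqP.
rewrite -[X in X = _](expr0 z) => /(congr1 (fun f => lcoef f 0)) /eqP.
have /negPf kN0 : (0 : int) != k%:Z by lia.
by rewrite !lcoef_expX kN0 eqxx oner_eq0.
Qed.

End LaurentMonomials.

Lemma laurent_eqN (F : numFieldType) (f : laurent F) : f = - f -> f = 0.
Proof.
move=> fN; apply: laurentP => n; apply/eqP; rewrite -eqNr.
by apply/eqP; rewrite [in RHS]fN.
Qed.

(** * Integer indices for half-integers, and uniqueness *)

Lemma halfint_ofE (a : halfint) : exists i, a = halfint_of i.
Proof.
case: a => q hq; have /intrP[i iE] : q - 1 / 2 \is a Num.int by [].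
by exists i; apply: val_inj => /=; rewrite -iE addrC subrK.
Qed.

Lemma halfint_ofD (i k : int) : halfint_add (halfint_of i) k = halfint_of (i + k).
Proof. by apply: val_inj => /=; rewrite rmorphD addrA. Qed.

Lemma halfint_ofN (i : int) : halfint_opp (halfint_of i) = halfint_of (- i - 1).
Proof. by apply: val_inj => /=; rewrite rmorphB rmorphN /=; lra. Qed.

(* [d i j] stands for the value at a = i + 1/2, b = j + 1/2, so that
   negating a amounts to [i |-> - i - 1]. *)
Lemma vanishing_by_recursion (K : nzRingType) (lam mu : K) (d : int -> int -> K) :
  (forall i j,
     d i j * lam = d (i + 1) j + d (i - 1) j + d i (j + 1) + d i (j - 1)) ->
  (forall i j,
     d i j * mu = d (i + 1) (j + 1) + d (i + 1) (j - 1)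
                  + d (i - 1) (j + 1) + d (i - 1) (j - 1) + d i j) ->
  (forall i j, d i j = - d j i) ->
  (forall i j, d i j = - d (- j - 1) (- i - 1)) ->
  (forall i, d i i = 0) -> (forall i, d i (- i - 1) = 0) ->
  d 1 0 = 0 -> d 1 (-1) = 0 ->
  forall i j, d i j = 0.
Proof.
move=> c1 c2 sw sN wall wallN d10 d1N.
(* In the indices, |b| <= a reads [- i - 1 <= j <= i]. *)
have cone (n : nat) : forall i j, 0 <= i <= n%:Z -> - i - 1 <= j <= i -> d i j = 0.
  elim: n => [|n IH] i j iP jP.
    have [jE|jE] : j = i \/ j = - i - 1 by lia.
      by rewrite jE wall.
    by rewrite jE wallN.
  have [jE|ji] := eqVneq j i; first by rewrite jE wall.
  have [jE|jNi] := eqVneq j (- i - 1); first by rewrite jE wallN.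
  have [i_n|i_n] := boolP (i <= n%:Z); first by apply: IH; lia.
  (* Off the walls, row [i = 1] contains only the two points prescribed by (c4). *)
  have [n0|n0] := eqVneq n 0%N.
    have -> : i = 1 by lia.
    have [->//|->//] : j = 0 \/ j = -1 by lia.
  have inner k : - i + 1 <= k <= i - 2 -> d i k = 0.
    move=> kP; have := c1 (i - 1) k.
    rewrite subrK !(IH (i - 1)) ?(IH (i - 1 - 1)); try lia.
    by rewrite mul0r !addr0.
  have [|jout] := boolP (- i + 1 <= j <= i - 2); first exact: inner.
  have [jE|jE] : j = i - 1 \/ j = - i by lia.
    have := c2 (i - 1) (i - 2).
    rewrite subrK (inner (i - 2 - 1)) ?(IH (i - 1)) ?(IH (i - 1 - 1) (i - 2 - 1)); try lia.
    (* The neighbour [(i - 2, i - 1)] lies outside the cone; reflecting it in u = 0 gives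
       [(i - 1, i - 2)], covered by [IH]. *)
    rewrite (sw (i - 1 - 1)) (_ : i - 2 + 1 = i - 1); last lia.
    by rewrite (IH (i - 1)) ?oppr0 ?mul0r ?addr0 -?jE//; lia.
  have := c2 (i - 1) (- i + 1).
  rewrite subrK (inner (- i + 1 + 1)) ?(IH (i - 1) (- i + 1))
    ?(IH (i - 1 - 1) (- i + 1 + 1)); try lia.
  (* Likewise [(i - 2, - i)] is reflected in v = 0 to [(i - 1, - i + 1)]. *)
  rewrite (sN (i - 1 - 1)) addrK (IH (- - i - 1)); try lia.
by rewrite oppr0 mul0r !addr0 add0r -jE.
(* The walls cut the plane into four cones, which [sw] and [sN] carry to the one treated. *)
move=> i j; pose n := (`|i| + `|j| + 1)%N.
have [ij|] := boolP ((- i - 1 <= j <= i) && (0 <= i)).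
  by apply: (cone n); lia.
have [ij _|] := boolP ((- j - 1 <= i <= j) && (0 <= j)).
  by rewrite sw (cone n) ?oppr0//; lia.
have [ij _ _|ij1 ij2 ij3] := boolP ((j <= i <= - j - 1) && (j < 0)).
  by rewrite sN (cone n) ?oppr0//; lia.
by rewrite sN sw opprK (cone n)//; lia.
Qed.

Lemma psi_spec_unique (R : realType) (psi phi : psi_family R) :
  psi_spec psi -> psi_spec phi -> forall s a b, psi s a b = phi s a b.
Proof.
move=> [p1 p2 p3 p4] [q1 q2 q3 q4] s a b.
have [[i ->] [j ->]] := (halfint_ofE a, halfint_ofE b).
pose d i j := psi s (halfint_of i) (halfint_of j) - phi s (halfint_of i) (halfint_of j).
have sw k l : d k l = - d l k.
  have [E _ _] := p3 (halfint_of k) (halfint_of l) s.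
  have [E' _ _] := q3 (halfint_of k) (halfint_of l) s.
  by rewrite /d E E' opprB opprK addrC.
have sN k l : d k l = - d (- l - 1) (- k - 1).
  have [_ E _] := p3 (halfint_of k) (halfint_of l) s.
  have [_ E' _] := q3 (halfint_of k) (halfint_of l) s.
  by rewrite /d E E' !halfint_ofN opprB opprK addrC.
apply/eqP; rewrite -subr_eq0 -/(d i j); apply/eqP.
pose z := laurentX R[i].
apply: (vanishing_by_recursion _ (z ^+ 3 + z + z^-1 + z ^- 3)
         (z ^+ 4 + z ^+ 2 + 1 + z ^- 2 + z ^- 4) d) => //.
- move=> k l; rewrite /d mulrBl p1 q1 !halfint_ofD; ring.
- move=> k l; rewrite /d mulrBl p2 q2 !halfint_ofD; ring.
(* Each reflection fixes its own wall, so there [d] equals its own negative. *)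
- by move=> k; apply: laurent_eqN; exact: sw.
- move=> k; apply: laurent_eqN; rewrite [LHS]sN; congr (- d _ _); lia.
- by rewrite /d (p4 s).1 (q4 s).1 subrr.
- by rewrite /d (p4 s).2 (q4 s).2 subrr.
Qed.

(** * The closed formula as a rational function of x, y and z *)

Section RationalIdentities.
Variables (K : fieldType) (z : K).
Hypothesis z0 : z != 0.

(* [x] and [y] stand for z^(a - b) and z^(a + b), and [zs] for z^s. *)
Definition psi_xy (zs x y : K) : K :=
  (zs * (z ^+ 5 * ((x - x^-1) * (y ^+ 2 - y ^- 2))
         - z ^+ 6 * ((x ^+ 2 - x ^- 2) * (y - y^-1))))
  / ((1 - z ^+ 2) ^+ 2 * (1 - z ^+ 4) * (1 - z ^+ 6)).

Lemma psi_xy_expand (s : nat) (x y : K) :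
  (z ^+ (5 + s) * (x ^ 1 * y ^ 2 - x ^ (-1) * y ^ 2
                   - x ^ 1 * y ^ (-2) + x ^ (-1) * y ^ (-2))
   - z ^+ (6 + s) * (x ^ 2 * y ^ 1 - x ^ (-2) * y ^ 1
                     - x ^ 2 * y ^ (-1) + x ^ (-2) * y ^ (-1)))
  / ((1 - z ^+ 2) ^+ 2 * (1 - z ^+ 4) * (1 - z ^+ 6)) = psi_xy (z ^+ s) x y.
Proof.
have eP1 (t : K) : t ^ 1 = t by [].
have eP2 (t : K) : t ^ 2 = t ^+ 2 by [].
have eN2 (t : K) : t ^ (-2) = t ^- 2 by [].
rewrite /psi_xy; congr (_ / _).
rewrite !eP1 !eP2 !eN2 !exprN1 ![z ^+ (_ + s)]exprD; ring.
Qed.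

(** Summing over the shifts by z and 1/z multiplies t - 1/t by z + 1/z and t^2 - 1/t^2 by z^2 +
    1/z^2. Both terms of the numerator thus acquire the factor (z + 1/z)(z^2 + 1/z^2). *)
Lemma psi_xy_c1 (zs x y : K) : x != 0 -> y != 0 ->
  psi_xy zs x y * (z ^+ 3 + z + z^-1 + z ^- 3) =
  psi_xy zs (x * z) (y * z) + psi_xy zs (x / z) (y / z)
  + psi_xy zs (x / z) (y * z) + psi_xy zs (x * z) (y / z).
Proof.
move=> x0 y0; rewrite /psi_xy mulrAC -!mulrDl; congr (_ / _).
by field; rewrite z0 x0 y0.
Qed.

(** Here one variable moves at a time, by z^2 or its inverse: the factors z^2 + z^-2 and z^4 + z^-4
    add up, the same for both terms. *)
Lemma psi_xy_c2 (zs x y : K) : x != 0 -> y != 0 ->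
  psi_xy zs x y * (z ^+ 4 + z ^+ 2 + 1 + z ^- 2 + z ^- 4) =
  psi_xy zs x (y * z ^+ 2) + psi_xy zs (x * z ^+ 2) y
  + psi_xy zs (x / z ^+ 2) y + psi_xy zs x (y / z ^+ 2) + psi_xy zs x y.
Proof.
move=> x0 y0; rewrite /psi_xy mulrAC -!mulrDl; congr (_ / _).
by field; rewrite z0 x0 y0.
Qed.

Lemma psi_xyVl (zs x y : K) : psi_xy zs x^-1 y = - psi_xy zs x y.
Proof.
by rewrite /psi_xy -[RHS]mulNr; congr (_ / _); rewrite !exprVn !invrK; ring.
Qed.

Lemma psi_xyVr (zs x y : K) : psi_xy zs x y^-1 = - psi_xy zs x y.
Proof.
by rewrite /psi_xy -[RHS]mulNr; congr (_ / _); rewrite !exprVn !invrK; ring.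
Qed.

(** The weights z^5 and z^6 make the numerator collapse to (1 - z^2)^2 (1 - z^4) times [zs], resp.
    z^3 [zs]. *)
Lemma psi_xy_c4 (zs : K) :
  1 - z ^+ 2 != 0 -> 1 - z ^+ 4 != 0 -> 1 - z ^+ 6 != 0 ->
  psi_xy zs z (z ^+ 2) = zs / (1 - z ^+ 6) /\
  psi_xy zs (z ^+ 2) z = z ^+ 3 * zs / (1 - z ^+ 6).
Proof.
by move=> n2 n4 n6; rewrite /psi_xy; split; field; rewrite z0 n2 n4 n6.
Qed.

End RationalIdentities.

(** * The closed formula satisfies (c1) to (c4) *)

Section ClosedFormula.
Variable R : realType.
Local Notation z := (laurentX R[i]).

Lemma laurentXpowE (q : rat) (n : int) : q = n%:~R -> laurentXpow R[i] q = z ^ n.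
Proof. by move=> ->; rewrite /laurentXpow intrKfloor. Qed.

Lemma psi_formula_xy (s : 'I_2) (i j : int) :
  psi_formula R s (halfint_of i) (halfint_of j) =
  psi_xy _ z (z ^+ s) (z ^ (i - j)) (z ^ (i + j + 1)).
Proof.
(* As [laurentXpow] takes a floor, each exponent is first shown to be an integer k u + l v, e.g. 3a
   + b = u + 2v; the two halves in a + b account for the 1 in v. *)
have E (q : rat) (k l : int) : q = (k * (i - j) + l * (i + j + 1))%:~R ->
    laurentXpow R[i] q = (z ^ (i - j)) ^ k * (z ^ (i + j + 1)) ^ l.
  move=> qE; rewrite (laurentXpowE _ _ qE) expfzDr ?laurentX_neq0//.
  by rewrite !exprz_exp ![_ * k]mulrC ![_ * l]mulrC.
rewrite /psi_formula.
rewrite (E _ 1 2); last by rewrite /=; lra.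
rewrite (E _ (-1) 2); last by rewrite /=; lra.
rewrite (E _ 1 (-2)); last by rewrite /=; lra.
rewrite (E _ (-1) (-2)); last by rewrite /=; lra.
rewrite (E _ 2 1); last by rewrite /=; lra.
rewrite (E _ (-2) 1); last by rewrite /=; lra.
rewrite (E _ 2 (-1)); last by rewrite /=; lra.
rewrite (E _ (-2) (-1)); last by rewrite /=; lra.
exact: psi_xy_expand.
Qed.

Lemma psi_formula_spec : @psi_spec R (fun s a b => psi_formula R s a b).
Proof.
have z0 := @laurentX_neq0 R[i].
have zu (u : int) : z ^ u != 0 by rewrite expfz_neq0.
have zS (u : int) : z ^ (u + 1) = z ^ u * z by rewrite expfzDr.
have zP (u : int) : z ^ (u - 1) = z ^ u / z by rewrite expfzDr.
have zSS (u : int) : z ^ (u + 2) = z ^ u * z ^+ 2 by rewrite expfzDr.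
have zPP (u : int) : z ^ (u - 2) = z ^ u / z ^+ 2 by rewrite expfzDr.
split.
- move=> a b s; have [[i ->] [j ->]] := (halfint_ofE a, halfint_ofE b).
  rewrite !halfint_ofD !psi_formula_xy.
  rewrite (_ : i + 1 - j = i - j + 1); last lia.
  rewrite (_ : i + 1 + j + 1 = i + j + 1 + 1); last lia.
  rewrite (_ : i - 1 - j = i - j - 1); last lia.
  rewrite (_ : i - 1 + j + 1 = i + j + 1 - 1); last lia.
  rewrite (_ : i - (j + 1) = i - j - 1); last lia.
  rewrite (_ : i + (j + 1) + 1 = i + j + 1 + 1); last lia.
  rewrite (_ : i - (j - 1) = i - j + 1); last lia.
  rewrite (_ : i + (j - 1) + 1 = i + j + 1 - 1); last lia.
  rewrite (zS (i - j)) (zS (i + j + 1)) !zP.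
  exact: (psi_xy_c1 _ _ z0 _ _ _ (zu _) (zu _)).
- move=> a b s; have [[i ->] [j ->]] := (halfint_ofE a, halfint_ofE b).
  rewrite !halfint_ofD !psi_formula_xy.
  rewrite (_ : i + 1 - (j + 1) = i - j); last lia.
  rewrite (_ : i + 1 + (j + 1) + 1 = i + j + 1 + 2); last lia.
  rewrite (_ : i + 1 - (j - 1) = i - j + 2); last lia.
  rewrite (_ : i + 1 + (j - 1) + 1 = i + j + 1); last lia.
  rewrite (_ : i - 1 - (j + 1) = i - j - 2); last lia.
  rewrite (_ : i - 1 + (j + 1) + 1 = i + j + 1); last lia.
  rewrite (_ : i - 1 - (j - 1) = i - j); last lia.
  rewrite (_ : i - 1 + (j - 1) + 1 = i + j + 1 - 2); last lia.
  rewrite !zSS !zPP.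
  exact: (psi_xy_c2 _ _ z0 _ _ _ (zu _) (zu _)).
- move=> a b s; have [[i ->] [j ->]] := (halfint_ofE a, halfint_ofE b).
  rewrite !halfint_ofN !psi_formula_xy.
  (* The three symmetries negate u, v, and both, respectively. *)
  rewrite (_ : j - i = - (i - j)); last lia.
  rewrite (_ : j + i + 1 = i + j + 1); last lia.
  rewrite (_ : - j - 1 - (- i - 1) = i - j); last lia.
  rewrite (_ : - j - 1 + (- i - 1) + 1 = - (i + j + 1)); last lia.
  rewrite (_ : - i - 1 - (- j - 1) = - (i - j)); last lia.
  rewrite (_ : - i - 1 + (- j - 1) + 1 = - (i + j + 1)); last lia.
  by rewrite -!invr_expz !(psi_xyVl, psi_xyVr) !opprK.
- move=> s; rewrite !psi_formula_xy [z ^+ (3 + s)]exprD.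
  by apply: psi_xy_c4; rewrite ?laurentX_sub1_neq0.
Qed.

End ClosedFormula.

Theorem theorem11p5 (R : realType) :
  (exists! psi : psi_family R, psi_spec psi) /\
  (forall psi : psi_family R, psi_spec psi ->
     forall (a b : halfint) (s : 'I_2), psi s a b = psi_formula R s a b).
Proof.
have spec := psi_formula_spec R; split=> [|psi psiP a b s].
  exists (fun s a b => psi_formula R s a b); split=> // psi psiP.
  apply: funext => s; apply: funext => a; apply: funext => b.
  exact: (psi_spec_unique _ _ _ spec psiP).
exact: (psi_spec_unique _ _ _ psiP spec).
Qed.
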